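(* Let $G$ be a (not necessarily finitely generated) group hyperbolic relative to a collection of subgroups $\{H_\lambda\}_{\lambda\in\Lambda}$. There exist only finitely many conjugacy classes of hyperbolic elements of finite order in $G$. In particular, the set of orders of hyperbolic elements of $G$ is finite.
   Context: An element $g\in G$ is hyperbolic if $g$ is not conjugate in $G$ to an element of one of the subgroups $H_\lambda$, $\lambda\in\Lambda$. Relative hyperbolicity. A subset $X\subseteq G$ is a relative generating set of $G$ with respect to $\{H_\lambda\}_{\lambda\in\Lambda}$ if $G$ is generated by $X\cup\bigcup_{\lambda}H_\lambda$. Put $F=(\ast_{\lambda\in\Lambda}\widetilde H_\lambda)\ast F(X)$, where $\widetilde H_\lambda$ is an isomorphic copy of $H_\lambda$ and $F(X)$ is free with basis $X$, and $\mathcal H=\bigsqcup_{\lambda\in\Lambda}(\widetilde H_\lambda\setminus\{1\})$. A finite relative presentation $\langle X,H_\lambda,\lambda\in\Lambda\mid R=1,R\in\mathcal R\rangle$ of $G$ consists of a finite relative generating set $X$ and a finite set $\mathcal R$ of words over $X^{\pm1}\cup\mathcal H$ (closed under cyclic shifts and inverses) whose normal closure in $F$ is the kernel of the canonical epimorphism $F\to G$. Its relative Dehn function is the smallest function $f$ such that every word $W$ over $X^{\pm1}\cup\mathcal H$ of length at most $n$ representing $1$ in $G$ equals in $F$ a product $\prod_{i=1}^kf_i^{-1}R_if_i$ with $R_i\in\mathcal R$, $f_i\in F$, $k\le f(n)$. $G$ is hyperbolic relative to $\{H_\lambda\}_{\lambda\in\Lambda}$ if it has a finite relative presentation whose relative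 Dehn function is bounded from above by $Ln$ for some constant $L$. *)

(* Defs.v *)
From HB Require Import structures.
From mathcomp Require Import all_boot.
From mathcomp Require Import boolp classical_sets cardinality.
From Stdlib Require Import Relations.

Set Implicit Arguments.
Unset Strict Implicit.
Unset Printing Implicit Defensive.

Local Open Scope classical_set_scope.
Local Open Scope group_scope.
Local Open Scope quotient_scope.

(* A subgroup of [G] is a [groupClosed G].  Its membership predicate is boolean,
   which is no restriction since [boolp] decides every proposition. *)

Section GroupNotions.
Variable G : groupType.

Definition conjugate (x y : G) : Prop := exists z : G, y = x ^ z.

Definition conj_class (x : G) : set G := [set y | conjugate x y].

Definition finite_order (x : G) : Prop := exists n, (0 < n)%N && (x ^+ n == 1).

(* [None] stands for infinite order. *)
Definition element_order (x : G) : option nat :=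
  if pselect (finite_order x) is left ex then Some (ex_minn ex) else None.

Definition generated (A : set G) : set G :=
  [set x | forall K : groupClosed G, (forall a, A a -> a \in K) -> x \in K].

Definition normal_closure (A : set G) : set G :=
  [set x | forall N : groupClosed G,
     (forall a b : G, a \in N -> a ^ b \in N) ->
     (forall a, A a -> a \in N) -> x \in N].

End GroupNotions.

Definition kernel (G K : groupType) (f : G -> K) : set G := [set x | f x = 1].

(* A finite subset X of G is given by a sequence, [seq_sub X] being the type of
   its elements. *)

Section RelativeWords.
Variables (G : groupType) (Lambda : Type) (H : Lambda -> groupClosed G).
Variable X : seq G.

(* The alphabet: [Gen x false] is the letter x, [Gen x true] the letter x^-1,
   and [Per l h] the copy of h in the l-th summand of the disjoint union of the
   sets of nontrivial elements of the H_l. *)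
Inductive letter : Type :=
  | Gen of seq_sub X & bool
  | Per (l : Lambda) of {h : G | (h \in H l) && (h != 1)}.

HB.instance Definition _ := gen_eqMixin letter.
HB.instance Definition _ := gen_choiceMixin letter.

Definition word := seq letter.

Definition letter_val (a : letter) : G :=
  match a with
  | Gen x b => if b then (val x)^-1 else val x
  | Per _ h => val h
  end.

Definition word_val (w : word) : G := \prod_(a <- w) letter_val a.

Lemma inv_letter_subproof l (h : {h : G | (h \in H l) && (h != 1)}) :
  ((val h)^-1 \in H l) && ((val h)^-1 != 1).
Proof.
have /andP[hH h1] := valP h.
by rewrite gpredV hH -(inj_eq invg_inj) invgK invg1.
Qed.

Definition inv_letter (a : letter) : letter :=
  match a with
  | Gen x b => Gen x (~~ b)
  | Per l h => Per (Sub (val h)^-1 (inv_letter_subproof h))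
  end.

Definition inv_word (w : word) : word := rev (map inv_letter w).

(* The free product F of copies of the groups H_l and of the free group on X is
   the monoid of words modulo the congruence generated by these rewritings. *)
Inductive word_step : word -> word -> Prop :=
  | step_gen u v x b :
      word_step (u ++ [:: Gen x b; Gen x (~~ b)] ++ v) (u ++ v)
  | step_per1 u v l (h k : {h : G | (h \in H l) && (h != 1)}) :
      val h * val k = 1 ->
      word_step (u ++ [:: Per h; Per k] ++ v) (u ++ v)
  | step_perM u v l (h k m : {h : G | (h \in H l) && (h != 1)}) :
      val h * val k = val m ->
      word_step (u ++ [:: Per h; Per k] ++ v) (u ++ [:: Per m] ++ v).

Definition word_equiv : rel word :=
  fun u v => `[< clos_refl_sym_trans word word_step u v >].

Lemma word_equiv_is_equiv : equiv_class_of word_equiv.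
Proof.
split=> [u | u v | v u w].
- by apply/asboolP/rst_refl.
- by apply/asboolP/asboolP; apply: rst_sym.
- by move=> /asboolP uv /asboolP vw; apply/asboolP/(rst_trans _ _ _ _ _ uv vw).
Qed.

Canonical word_equiv_rel := EquivRelPack word_equiv_is_equiv.

Definition relfree : Type := {eq_quot word_equiv_rel}.
HB.instance Definition _ := Choice.on relfree.
HB.instance Definition _ := EqQuotient.on relfree.

Definition word_class (w : word) : relfree := \pi_relfree w.

Lemma word_classP u v :
  word_class u = word_class v <-> clos_refl_sym_trans word word_step u v.
Proof.
split=> [/eqmodP/asboolP //|uv].
by apply/eqmodP/asboolP.
Qed.

Lemma word_equiv_cat u u' v v' :
    clos_refl_sym_trans word word_step u u' ->
    clos_refl_sym_trans word word_step v v' ->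
  clos_refl_sym_trans word word_step (u ++ v) (u' ++ v').
Proof.
move=> uu' vv'; apply: (@rst_trans _ _ _ (u' ++ v)).
- elim: uu' => [a b [] *|a|a b _|a b c _ + _]; last exact: rst_trans.
  + by rewrite -!catA; apply/rst_step/step_gen.
  + by rewrite -!catA; apply/rst_step/step_per1.
  + by rewrite -!catA; apply/rst_step/step_perM.
  + exact: rst_refl.
  + exact: rst_sym.
- elim: vv' => [a b [] *|a|a b _|a b c _ + _]; last exact: rst_trans.
  + by rewrite ![u' ++ _ ++ _]catA; apply/rst_step/step_gen.
  + by rewrite ![u' ++ _ ++ _]catA; apply/rst_step/step_per1.
  + by rewrite ![u' ++ _ ++ _]catA; apply/rst_step/step_perM.
  + exact: rst_refl.
  + exact: rst_sym.
Qed.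

Lemma inv_letterK : involutive inv_letter.
Proof.
case=> [x b|l h] /=; first by rewrite negbK.
by congr Per; apply: val_inj => /=; rewrite invgK.
Qed.

Lemma inv_wordK : involutive inv_word.
Proof.
by move=> w; rewrite /inv_word map_rev revK -map_comp (eq_map inv_letterK) map_id.
Qed.

Lemma inv_wordV w :
  clos_refl_sym_trans word word_step (w ++ inv_word w) [::].
Proof.
elim: w => [|a w IHw]; first exact: rst_refl.
rewrite /inv_word map_cons rev_cons -/(inv_word w) -cats1 -cat1s -catA.
apply: (@rst_trans _ _ _ ([:: a] ++ [:: inv_letter a])).
  apply: (word_equiv_cat (u := [:: a])); first exact: rst_refl.
  rewrite catA.
  exact: (word_equiv_cat (u' := [::]) IHw (rst_refl _ _ [:: inv_letter a])).
case: a => [x b|l h] /=; apply: rst_step.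
  exact: (step_gen [::] [::]).
by apply: (step_per1 [::] [::]); rewrite mulgV.
Qed.

Lemma word_val_equiv u v :
  clos_refl_sym_trans word word_step u v -> word_val u = word_val v.
Proof.
elim=> [a b []|a|a b _ ->|a b c _ -> _ ->] //.
- move=> {}u {}v x e; rewrite /word_val !big_cat !big_cons big_nil /=.
  by case: e => /=; rewrite mulg1 ?mulVg ?mulgV mul1g.
- move=> {}u {}v l h k hk; rewrite /word_val !big_cat !big_cons big_nil /=.
  by rewrite mulg1 hk mul1g.
- move=> {}u {}v l h k m hk; rewrite /word_val !big_cat !big_cons !big_nil /=.
  by rewrite !mulg1 hk.
Qed.

Definition relfree_one : relfree := word_class [::].
Definition relfree_mul (a b : relfree) : relfree :=
  word_class (repr a ++ repr b).
Definition relfree_inv (a : relfree) : relfree := word_class (inv_word (repr a)).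

Lemma word_class_repr a : word_class (repr a) = a.
Proof. exact: reprK. Qed.

Lemma word_class_cat u v :
  word_class (u ++ v) = relfree_mul (word_class u) (word_class v).
Proof.
by apply/word_classP/word_equiv_cat; apply/word_classP; rewrite word_class_repr.
Qed.

Lemma relfree_mulA : associative relfree_mul.
Proof.
move=> a b c; rewrite -(word_class_repr a) -(word_class_repr b).
by rewrite -(word_class_repr c) -!word_class_cat catA.
Qed.

Lemma relfree_mul1 : left_id relfree_one relfree_mul.
Proof.
by move=> a; rewrite -[in LHS](word_class_repr a) -word_class_cat word_class_repr.
Qed.

Lemma relfree_mulr1 : right_id relfree_one relfree_mul.
Proof.
move=> a; rewrite -[in LHS](word_class_repr a) -word_class_cat cats0.
exact: word_class_repr.
Qed.

Lemma relfree_mulV : right_inverse relfree_one relfree_inv relfree_mul.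
Proof.
move=> a; rewrite -{1}(word_class_repr a) -word_class_cat.
by apply/word_classP/inv_wordV.
Qed.

Lemma relfree_mulVl : left_inverse relfree_one relfree_inv relfree_mul.
Proof.
move=> a; rewrite -{2}(word_class_repr a) -word_class_cat.
by apply/word_classP; have := inv_wordV (inv_word (repr a)); rewrite inv_wordK.
Qed.

HB.instance Definition _ := isGroup.Build relfree
  relfree_mulA relfree_mul1 relfree_mulr1 relfree_mulVl relfree_mulV.

Definition canonical_map (a : relfree) : G := word_val (repr a).

Lemma canonical_mapE w : canonical_map (word_class w) = word_val w.
Proof. by apply/word_val_equiv/word_classP; rewrite word_class_repr. Qed.

Lemma canonical_map_monoid_morphism : monoid_morphism canonical_map.
Proof.
split=> [|a b]; first by rewrite /= (canonical_mapE [::]) /word_val big_nil.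
rewrite [a * b]/(relfree_mul a b) canonical_mapE.
exact: big_cat.
Qed.

HB.instance Definition _ := isUMagmaMorphism.Build relfree G canonical_map
  canonical_map_monoid_morphism.

Definition relative_generating_set : Prop :=
  generated [set g | g \in X \/ exists l, g \in H l] = setT.

Variable R : seq word.

Definition finite_relative_presentation : Prop :=
  [/\ relative_generating_set,
      forall r n, r \in R -> rot n r \in R,
      forall r, r \in R -> inv_word r \in R
    & normal_closure [set word_class r | r in [set` R]] = kernel canonical_map].

Definition product_of_conjugates (w : word) (k : nat) : Prop :=
  exists (f : 'I_k -> relfree) (r : 'I_k -> word),
    (forall i, r i \in R) /\
    word_class w = \prod_(i < k) (word_class (r i) ^ f i).

Definition relative_isoperimetric_function (f : nat -> nat) : Prop :=
  forall (n : nat) (w : word), (size w <= n)%N -> word_val w = 1 ->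
    exists2 k, (k <= f n)%N & product_of_conjugates w k.

Definition relative_Dehn_function (f : nat -> nat) : Prop :=
  relative_isoperimetric_function f /\
  forall f', relative_isoperimetric_function f' -> forall n, (f n <= f' n)%N.

End RelativeWords.

Section RelativelyHyperbolic.
Variables (G : groupType) (Lambda : Type) (H : Lambda -> groupClosed G).

Definition relatively_hyperbolic : Prop :=
  exists (X : seq G) (R : seq (word H X)),
    finite_relative_presentation R /\
    exists2 f : nat -> nat, relative_Dehn_function R f
      & exists L : nat, forall n, (f n <= L * n)%N.

Definition hyperbolic (g : G) : Prop :=
  ~ exists l, exists2 h : G, h \in H l & conjugate g h.

End RelativelyHyperbolic.

(* Main.v *)
Require Import Defs.
From HB Require Import structures.
From Stdlib Require Import Relations BinInt Znat ZArithRing.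
From mathcomp Require Import all_boot.
From mathcomp Require Import boolp classical_sets cardinality.
From mathcomp Require Import zify.

(* Let K be the coned-off Cayley graph of G: its vertices are the elements of G
   and the cosets g H_l, with edges from g to g x and from g to g H_l.  By the
   linear isoperimetric inequality, the 1-chain of a closed walk of length n in K
   is a sum of at most L n translates of relators.  Hence an antisymmetric
   function on edges whose integrals along relators are bounded has integral
   O(n) along closed walks of length n.  Two such functions are used.
   - The form f1 df2, for Lipschitz f1 and f2: this yields hyperbolicity of K.
   - The function on the edges at a given coset which measures the distance to a
     base point of the coset, with respect to the letters of the relators: this
     shows that, if two elements of a coset are joined by a short walk avoiding
     the cone point, then they are close for that distance.
   Let g have finite order and fix no vertex of K, and let p be a vertex of
   minimal displacement.  By the four-point condition d(p, g^2k p) is at most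
   d(p, g^k p) + delta, which bounds d(p, gp).  Extend a geodesic from p to gp to
   a g-invariant walk.  If this walk passed through a cone point v without a short
   detour around v, geodesics between translates of v would have to pass through
   all those in between, so that d(v, g^k v) = k d(v, gv) for bounded k,
   contradicting the inequality above.  So there are always short detours, and g
   is conjugate to a product of boundedly many elements of a finite set. *)

Set Implicit Arguments.
Unset Strict Implicit.
Unset Printing Implicit Defensive.

Local Open Scope classical_set_scope.

(** * Integrals of edge functions along walks *)

Section Integral.
Variables (V : Type) (w : V -> V -> Z).

Fixpoint integral (x : V) (p : seq V) : Z :=
  if p is y :: p' then (w x y + integral y p')%Z else 0%Z.

Lemma integral_cat x p q :
  integral x (p ++ q) = (integral x p + integral (last x p) q)%Z.
Proof.
by elim: p x => [|y p IHp] x //=; rewrite IHp; lia.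
Qed.

End Integral.

(** * Graphs with a linear Stokes bound are hyperbolic *)

Section GraphDistance.
Variables (V : eqType) (e : rel V).
Hypothesis e_sym : symmetric e.
Hypothesis e_conn : forall x y, exists p, path e x p /\ last x p = y.

(** Confining all vertices, ends included, to [S] serves for distances (with [S] trivial), for walks
    outside a ball and for walks avoiding a cone point. *)
Definition walk (S : V -> Prop) (x y : V) (n : nat) : Prop :=
  exists p, [/\ path e x p, last x p = y, size p = n
              & forall v, v \in x :: p -> S v].

Lemma walk_refl (S : V -> Prop) x : S x -> walk S x x 0.
Proof. by move=> Sx; exists [::]; split => // v; rewrite inE => /eqP ->. Qed.

Lemma walk_edge (S : V -> Prop) x y : S x -> S y -> e x y -> walk S x y 1.
Proof.
move=> Sx Sy exy; exists [:: y]; split; rewrite ?andbT //=; first by rewrite exy.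
by move=> v; rewrite !inE => /orP[] /eqP ->.
Qed.

Lemma walk_cat S x y z n m : walk S x y n -> walk S y z m -> walk S x z (n + m).
Proof.
move=> [p [pp pl <- pS]] [q [qp ql <- qS]]; exists (p ++ q); split.
- by rewrite cat_path pp pl.
- by rewrite last_cat pl.
- by rewrite size_cat.
- move=> v; rewrite -cat_cons mem_cat => /orP[/pS //|vq].
  by apply: qS; rewrite inE vq orbT.
Qed.

Lemma walk_sub (S S' : V -> Prop) x y n :
  (forall v, S v -> S' v) -> walk S x y n -> walk S' x y n.
Proof. by move=> SS' [p [? ? ? pS]]; exists p; split=> // v /pS /SS'. Qed.

Lemma walk_sym S x y n : walk S x y n -> walk S y x n.
Proof.
move=> [p [pp pl <- pS]].
elim: p x pp pl pS => [|u p IHp] x /=.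
  by move=> _ -> pS; apply: walk_refl; apply: pS; rewrite mem_head.
move=> /andP[exu pp] pl pS; rewrite -addn1.
apply: walk_cat (IHp u pp pl _) _ => [v vp|].
  by apply: pS; rewrite inE vp orbT.
by apply: walk_edge; rewrite 1?e_sym //; apply: pS; rewrite !inE eqxx ?orbT.
Qed.

Lemma walk_seq (S : V -> Prop) (s : nat -> V) i j : i <= j ->
  (forall k, i <= k -> k < j -> e (s k) (s k.+1)) ->
  (forall k, i <= k -> k <= j -> S (s k)) -> walk S (s i) (s j) (j - i).
Proof.
move=> ij; rewrite -(subnKC ij); elim: (j - i) => [|k IHk] es Ss.
  by rewrite addn0 subnn; apply/walk_refl/Ss; lia.
have -> : i + k.+1 - i = (i + k - i) + 1 by lia.
apply: walk_cat (IHk _ _) _ => [l ? ?|l ? ?|].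
- by apply: es; lia.
- by apply: Ss; lia.
- rewrite addnS; apply: walk_edge; [apply: Ss|apply: Ss|apply: es]; lia.
Qed.

Lemma dist_subproof x y : exists n, `[< walk (fun=> True) x y n >].
Proof.
by have [p [? ?]] := e_conn x y; exists (size p); apply/asboolP; exists p.
Qed.

Definition dist x y := ex_minn (dist_subproof x y).

Lemma dist_walk x y : walk (fun=> True) x y (dist x y).
Proof. by rewrite /dist; case: ex_minnP => n /asboolP. Qed.

Lemma dist_le S x y n : walk S x y n -> dist x y <= n.
Proof.
move=> wxy; rewrite /dist; case: ex_minnP => m _; apply; apply/asboolP.
exact: walk_sub wxy.
Qed.

Lemma distxx x : dist x x = 0.
Proof. by apply/eqP; rewrite -leqn0; apply/dist_le/walk_refl. Qed.

Lemma dist_eq0 x y : dist x y = 0 -> x = y.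
Proof. by have [[|u p] [_ <- <- _]] := dist_walk x y. Qed.

Lemma distC x y : dist x y = dist y x.
Proof.
by apply/eqP; rewrite eqn_leq !(dist_le (walk_sym (dist_walk _ _))).
Qed.

Lemma dist_tri z x y : dist x y <= dist x z + dist z y.
Proof.
exact: dist_le (walk_cat (dist_walk _ _) (dist_walk _ _)).
Qed.

Lemma dist_edge x y : e x y -> dist x y <= 1.
Proof. by move=> exy; apply: @dist_le (fun=> True) _ _ _ (walk_edge I I exy). Qed.

Definition geodesic (n : nat) (c : nat -> V) : Prop :=
  (forall i, i < n -> e (c i) (c i.+1)) /\
  (forall i j, i <= j -> j <= n -> dist (c i) (c j) = j - i).

(** The three pieces cut out by [i] and [j] have lengths adding up to [n], so none can be
    shortened. *)
Lemma geodesic_of_walk n c :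
  (forall i, i < n -> e (c i) (c i.+1)) -> n <= dist (c 0) (c n) ->
  geodesic n c.
Proof.
move=> ec dn; split=> // i j ij jn.
have le k l : k <= l -> l <= n -> dist (c k) (c l) <= l - k.
  move=> kl ln; apply: (@dist_le (fun=> True)).
  by apply: walk_seq => // m _ ml; apply: ec; lia.
have := dist_tri (c i) (c 0) (c n); have := dist_tri (c j) (c i) (c n).
have := le 0 i (leq0n _) (leq_trans ij jn); have := le j n jn (leqnn n).
have := le i j ij jn; lia.
Qed.

Lemma geodesic_exists x y :
  exists c, [/\ geodesic (dist x y) c, c 0 = x & c (dist x y) = y].
Proof.
have [p [pp pl ps _]] := dist_walk x y.
have cn : nth x (x :: p) (dist x y) = y.
  by rewrite -ps -[size p]/(size (x :: p)).-1 nth_last.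
exists (fun i => nth x (x :: p) i); split=> //.
apply: geodesic_of_walk; last by rewrite cn.
by move=> i; rewrite -ps; apply: (pathP x pp).
Qed.

Lemma geodesic_dist n c i j : geodesic n c -> i <= n -> j <= n ->
  dist (c i) (c j) = (i - j) + (j - i).
Proof.
move=> [_ gd] iN jN; case: (leqP i j) => ij; first by rewrite gd //; lia.
by rewrite distC gd; lia.
Qed.

Lemma geodesic_walk (S : V -> Prop) n c i j : geodesic n c ->
  i <= n -> j <= n -> (forall k, k <= n -> S (c k)) ->
  walk S (c i) (c j) (dist (c i) (c j)).
Proof.
move=> gc iN jN Sc; have [ec gd] := gc.
have main k l : k <= l -> l <= n -> walk S (c k) (c l) (dist (c k) (c l)).
  move=> kl ln; rewrite gd //; apply: walk_seq => // m _ ml; first by apply: ec; lia.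
  by apply: Sc; lia.
case: (leqP i j) => ij; first exact: main.
by rewrite distC; apply/walk_sym/main => //; lia.
Qed.

Definition lipschitz (f : V -> Z) :=
  forall u v, e u v -> (Z.abs (f u - f v) <= 1)%Z.

(* Twice the trapezoidal discretization of [f1 df2]; it is antisymmetric. *)
Definition form (f1 f2 : V -> Z) (u v : V) : Z :=
  ((f1 u + f1 v) * (f2 v - f2 u))%Z.

Definition stokes_bound (K : nat) : Prop :=
  forall f1 f2, lipschitz f1 -> lipschitz f2 ->
  forall x p, path e x p -> last x p = x ->
  (Z.abs (integral (form f1 f2) x p) <= Z.of_nat (K * size p))%Z.

(** Gromov's four-point condition; the disjunction stands for a bound by the maximum of two sums. *)
Definition four_point (delta : nat) : Prop :=
  forall x y z t,
    dist x y + dist z t <= dist x z + dist y t + delta \/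
    dist x y + dist z t <= dist x t + dist y z + delta.

Lemma dist_lipschitz y : lipschitz (fun v => Z.of_nat (dist y v)).
Proof.
move=> u v /dist_edge duv; have := dist_tri u y v; have := dist_tri v y u.
by rewrite (distC v u); lia.
Qed.

Lemma path_dist_le x p : path e x p -> dist x (last x p) <= size p.
Proof. by move=> pp; apply: (@dist_le (fun=> True)); exists p. Qed.

(** Every edge of the path leads one step away from [y], so its term is a sum of two values of
    [f1]. *)
Lemma form_integral_ge0 f1 y u p : (forall v, 0 <= f1 v)%Z -> path e u p ->
  dist y (last u p) = dist y u + size p ->
  (0 <= integral (form f1 (fun v => Z.of_nat (dist y v))) u p)%Z.
Proof.
move=> f1_ge0; elim: p u => [|v p IHp] u //= /andP[euv pp] dl.
have := dist_tri v y (last v p); have := path_dist_le pp.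
have := dist_edge euv; have := dist_tri u y v => t1 t2 t3 t4.
have dv : dist y v = (dist y u).+1 by lia.
have := IHp v pp; rewrite /form; have := f1_ge0 u; have := f1_ge0 v; nia.
Qed.

Definition tent (x : V) (D : nat) (v : V) : Z := Z.of_nat (D - dist x v).

Lemma tent_lipschitz x D : lipschitz (tent x D).
Proof. by move=> u v /(@dist_lipschitz x); rewrite /tent; lia. Qed.

(** At each edge the distance to [y] grows by one and the tent drops by one until it vanishes. So
    each term is a difference of squares, and the sum telescopes. *)
Lemma tent_integral x D y u p : path e u p ->
  dist y (last u p) = dist y u + size p -> dist x (last u p) = dist x u + size p ->
  (integral (form (tent x D) (fun v => Z.of_nat (dist y v))) u p =
   tent x D u * tent x D u - tent x D (last u p) * tent x D (last u p))%Z.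
Proof.
elim: p u => [|v p IHp] u /=; first by lia.
move=> /andP[euv pp] dly dlx.
have := dist_tri v y (last v p); have := dist_tri v x (last v p).
have := path_dist_le pp; have := dist_edge euv.
have := dist_tri u y v; have := dist_tri u x v => t1 t2 t3 t4 t5 t6.
rewrite IHp //; [|lia..]; rewrite /form /tent.
have -> : dist y v = (dist y u).+1 by lia.
have -> : dist x v = (dist x u).+1 by lia.
case: (leqP D (dist x u)) => Dx; nia.
Qed.

Lemma tent_integral_outside x D f2 u p :
  (forall v, v \in u :: p -> D <= dist x v) ->
  integral (form (tent x D) f2) u p = 0%Z.
Proof.
elim: p u => [|v p IHp] u //= out; rewrite IHp => [|t tp].
  have := out u (mem_head _ _); have := out v; rewrite !inE eqxx orbT => /(_ isT).
  by rewrite /form /tent; nia.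
by apply: out; rewrite inE tp orbT.
Qed.

(* Integrating the tent of height [D] at [x] against the distance to [y]
   detects only the part of the loop near [x], where it gives [D * D]. *)
Lemma ball_area_bound K x y z n D : stokes_bound K ->
  dist y z = dist y x + dist x z -> D <= dist x z ->
  walk (fun v => D <= dist x v) z y n -> D * D <= K * (dist y z + n).
Proof.
move=> stokes yxz Dz [p3 [pp3 pl3 ps3 out]].
have [p1 [pp1 pl1 ps1 _]] := dist_walk y x.
have [p2 [pp2 pl2 ps2 _]] := dist_walk x z.
have /(_ y (p1 ++ p2 ++ p3)) := stokes _ _ (@tent_lipschitz x D) (@dist_lipschitz y).
rewrite !cat_path !last_cat pl1 pl2 pp1 pp2 pp3 pl3 => /(_ isT erefl).
rewrite !integral_cat pl1 pl2 (tent_integral_outside _ out) (tent_integral _ pp2).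
- have t_ge0 v : (0 <= tent x D v)%Z by rewrite /tent; lia.
  have := form_integral_ge0 t_ge0 pp1 (y := y); rewrite pl1 distxx ps1 => /(_ erefl).
  rewrite pl2 /tent distxx !size_cat ps1 ps2 ps3 (eqP Dz) yxz subn0.
  by set I1 := integral _ _ _; lia.
- by rewrite pl2 ps2.
- by rewrite pl2 distxx ps2.
Qed.

(** * Right angles between geodesics *)

Section RightAngle.
Variables (K : nat) (p : V) (n : nat) (c : nat -> V).
Hypothesis stokes : stokes_bound K.
Hypothesis gc : geodesic n c.
Hypothesis c0_nearest : forall i, i <= n -> dist p (c 0) <= dist p (c i).
Variable s : nat -> V.
Hypothesis gs : geodesic (dist (c 0) p) s.
Hypothesis s0 : s 0 = c 0.
Hypothesis sp : s (dist (c 0) p) = p.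

Local Notation m := (dist (c 0) p).

Definition on_legs (v : V) : Prop :=
  (exists2 i, i <= n & v = c i) \/ (exists2 k, k <= m & v = s k).

(** The point [s k] is at distance [m - k] from [p], and no [c i] is nearer to [p] than [m]. *)
Lemma leg_dist i k : i <= n -> k <= m -> k <= dist (c i) (s k).
Proof.
move=> iN kM; have := c0_nearest iN; have := dist_tri (s k) p (c i).
rewrite (distC (s k)) (distC p (s k)) (distC p (c 0)) -[in dist (s k) p]sp.
by rewrite (geodesic_dist gs) //; lia.
Qed.

(* The legs of a right angle form a quasigeodesic. *)
Lemma on_legs_walk u v : on_legs u -> on_legs v ->
  exists2 r, r <= 3 * dist u v & walk on_legs u v r.
Proof.
have Lc i : i <= n -> on_legs (c i) by left; exists i.
have Ls k : k <= m -> on_legs (s k) by right; exists k.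
have mixed i k : i <= n -> k <= m ->
    exists2 r, r <= 3 * dist (c i) (s k) & walk on_legs (c i) (s k) r.
  (* Walk through the corner. If [d] is the distance of [c i] and [s k], then [k <= d] by [leg_dist]
     and [i <= d + k], so that [i + k <= 3 * d]. *)
  move=> iN kM; exists (dist (c i) (c 0) + dist (s 0) (s k)).
    have := leg_dist iN kM; have := dist_tri (s k) (c i) (c 0).
    rewrite (distC (s k)) -s0 (geodesic_dist gs) //; lia.
  apply: walk_cat (geodesic_walk gc iN _ Lc) _ => //.
  by rewrite -s0; apply: (geodesic_walk gs).
move=> [[i iN ->]|[k kM ->]] [[j jN ->]|[l lM ->]].
- by exists (dist (c i) (c j)); [lia | apply: (geodesic_walk gc)].
- exact: mixed.
- have [r rd wr] := mixed j k jN kM.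
  by exists r; [rewrite distC | apply: walk_sym].
- by exists (dist (s k) (s l)); [lia | apply: (geodesic_walk gs)].
Qed.

Variable h : nat -> V.
Hypothesis gh : geodesic (dist (c n) p) h.
Hypothesis h0 : h 0 = c n.
Hypothesis hp : h (dist (c n) p) = p.

(** Let [D] be the largest distance to the legs, attained at [u]. Go from the point [2 * D] after
    [u] to the legs, along them, and back to the point [2 * D] before [u], staying at distance at
    least [D] from [u]. This takes at most [D + 18 * D + D], since the ends on the legs are at
    distance at most [6 * D]. With the chord of length at most [4 * D], [ball_area_bound] gives
    [D * D <= K * (24 * D)]. *)
Lemma hypotenuse_near_legs j : j <= dist (c n) p ->
  exists2 v, on_legs v & dist (h j) v <= 24 * K.
Proof.
set l := dist (c n) p => jl.
pose far D := `[< exists2 j, j <= l & forall v, on_legs v -> D <= dist (h j) v >].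
have far0 : exists D, far D by exists 0; apply/asboolP; exists 0.
have far_le D : far D -> D <= l.
  move=> /asboolP[i il]; move=> /(_ p).
  rewrite -[in dist _ p]hp (geodesic_dist gh) //.
  by move=> /(_ ltac:(by right; exists m; rewrite ?sp)); lia.
case: (ex_maxnP far0 far_le) => D /asboolP[{}i il farD] maxD.
have near k : k <= l -> exists2 v, on_legs v & dist (h k) v <= D.
  move=> kl; apply: contrapT => no; have /maxD : far D.+1; last by rewrite ltnn.
  apply/asboolP; exists k => // v Lv; rewrite ltnNge; apply/negP => ?.
  by apply: no; exists v.
suff D24 : D <= 24 * K.
  by have [v Lv ?] := near j jl; exists v => //; lia.
set u := h i in farD.
(* A walk of length at most [D] that starts at distance at least [2 * D] from [u] stays at distance
   at least [D]. *)
have escape k : k <= l -> on_legs (h k) \/ 2 * D <= dist u (h k) ->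
    exists w r, [/\ on_legs w, r <= D, dist (h k) w <= D
                  & walk (fun v => D <= dist u v) (h k) w r].
  move=> kl [Lk|uk].
    exists (h k), 0; rewrite distxx; split=> //; exact/walk_refl/farD.
  have [v Lv kv] := near k kl.
  have [g [gg g0 gv]] := geodesic_exists (h k) v.
  exists v, (dist (h k) v); split=> //.
  have := @geodesic_walk (fun v => D <= dist u v) _ g 0 (dist (h k) v) gg.
  rewrite g0 gv; apply=> // t tl; have := geodesic_dist gg (leq0n _) tl.
  by rewrite g0; have := dist_tri (g t) u (h k); rewrite (distC (g t)); lia.
(* Both indices are cut off at the ends of the hypotenuse, which lie on the legs; there no walk to
   the legs is required. *)
have jy : i - 2 * D <= l by lia.
have jz : minn (i + 2 * D) l <= l by lia.
have hyz : minn (i + 2 * D) l = l \/ minn (i + 2 * D) l = i + 2 * D by lia.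
have Lp : on_legs p by right; exists m.
have [y [ry [Ly ryD dy wy]]] : exists w r, [/\ on_legs w, r <= D,
    dist (h (i - 2 * D)) w <= D
    & walk (fun v => D <= dist u v) (h (i - 2 * D)) w r].
  apply: escape => //; case: (leqP (2 * D) i) => iD.
    by right; rewrite (geodesic_dist gh) //; lia.
  by left; left; exists n => //; rewrite -h0; congr h; lia.
have [z [rz [Lz rzD dz wz]]] : exists w r, [/\ on_legs w, r <= D,
    dist (h (minn (i + 2 * D) l)) w <= D
    & walk (fun v => D <= dist u v) (h (minn (i + 2 * D) l)) w r].
  apply: escape => //; case: hyz => hyz.
    by left; rewrite hyz hp.
  by right; rewrite (geodesic_dist gh) //; lia.
have [r rd wr] := on_legs_walk Lz Ly.
have {}wr := walk_sub farD wr.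
have := ball_area_bound stokes _ _ (walk_cat wz (walk_cat wr (walk_sym wy))).
rewrite !(geodesic_dist gh) // => /(_ ltac:(lia)).
have [-> //|D0] := posnP D.
have -> : D <= i - minn (i + 2 * D) l + (minn (i + 2 * D) l - i).
  case: hyz => hyz; last by lia.
  by have := farD _ Lp; rewrite -[in dist _ p]hp (geodesic_dist gh) //; lia.
move=> /(_ isT).
have := dist_tri (h (minn (i + 2 * D) l)) z y.
have := dist_tri (h (i - 2 * D)) (h (minn (i + 2 * D) l)) y.
rewrite (distC z (h _)) !(geodesic_dist gh) // => t1 t2.
have : i - 2 * D - minn (i + 2 * D) l + (minn (i + 2 * D) l - (i - 2 * D)) +
  (rz + (r + ry)) <= 24 * D by lia.
by set S := (X in X <= _) => SD; nia.
Qed.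

(** Where the hypotenuse stops being near [c], it has a point [h j] within [24 * K] of some [c i]
    and within [24 * K + 1] of some [s k]. By [leg_dist], [k <= 48 * K + 1], so [h j] is within
    [72 * K + 2] of the corner; this error is counted once for each leg. *)
Lemma right_angle_aux : n + m <= dist (c n) p + (144 * K + 4).
Proof.
set l := dist (c n) p.
pose near_c j := (j <= l) && `[< exists2 i, i <= n & dist (h j) (c i) <= 24 * K >].
have ex0 : exists j, near_c j.
  exists 0; apply/andP; split=> //; apply/asboolP; exists n => //.
  by rewrite h0 distxx.
have le_l j : near_c j -> j <= l by case/andP.
case: (ex_maxnP ex0 le_l) => j /andP[jl /asboolP[i iN ji]] maxj.
have [k kM jk] : exists2 k, k <= m & dist (h j) (s k) <= 24 * K + 1.
  move: jl; rewrite leq_eqVlt => /orP[/eqP ->|jl].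
    by exists m => //; rewrite sp hp distxx.
  have [v [[i' i'N ->]|[k kM ->]] jv] := hypotenuse_near_legs jl.
    have /maxj : near_c j.+1; last by rewrite ltnn.
    by apply/andP; split=> //; apply/asboolP; exists i'.
  exists k => //; have := dist_tri (h j.+1) (h j) (s k).
  by rewrite (geodesic_dist gh) //; lia.
have := leg_dist iN kM; have := dist_tri (h j) (c i) (s k).
have := dist_tri (s k) (h j) (c 0); have := dist_tri (h j) (c n) (c 0).
have := dist_tri (h j) (c 0) p.
have -> : dist (h j) p = l - j.
  by rewrite -[in dist _ p]hp (geodesic_dist gh) //; lia.
have -> : dist (c n) (h j) = j by rewrite -h0 (geodesic_dist gh) //; lia.
have -> : dist (s k) (c 0) = k by rewrite -s0 (geodesic_dist gs) //; lia.
have -> : dist (c n) (c 0) = n by rewrite (geodesic_dist gc) //; lia.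
by rewrite (distC (c i) (h j)) (distC (c 0) (h j)); lia.
Qed.

End RightAngle.

(** The nearest point cuts the geodesic into two legs; the part before it is reversed. *)
Lemma right_angle K p n c a i : stokes_bound K -> geodesic n c -> a <= n ->
  (forall j, j <= n -> dist p (c a) <= dist p (c j)) -> i <= n ->
  dist (c a) (c i) + dist (c a) p <= dist (c i) p + (144 * K + 4).
Proof.
move=> stokes gc aN near iN.
have main l c' : geodesic l c' ->
    (forall j, j <= l -> dist p (c' 0) <= dist p (c' j)) ->
    dist (c' 0) (c' l) + dist (c' 0) p <= dist (c' l) p + (144 * K + 4).
  move=> gc' near'; rewrite (geodesic_dist gc') // subn0 sub0n add0n.
  have [s [gs s0 sp]] := geodesic_exists (c' 0) p.
  have [h [gh h0 hp]] := geodesic_exists (c' l) p.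
  by have := right_angle_aux stokes gc' near' gs s0 sp gh h0 hp.
have [ec gd] := gc.
case: (leqP a i) => ai.
  have := main (i - a) (fun j => c (a + j)); rewrite addn0 (subnKC ai); apply.
    split=> [j ji|j k jk ki]; first by rewrite addnS; apply: ec; lia.
    by rewrite gd; lia.
  by move=> j ji; apply: near; lia.
have := main (a - i) (fun j => c (a - j)); rewrite subn0 (subKn (ltnW ai)); apply.
  split=> [j ji|j k jk ki].
    have -> : a - j = (a - j.+1).+1 by lia.
    by rewrite e_sym; apply: ec; lia.
  by rewrite (geodesic_dist gc); lia.
by move=> j ji; apply: near; lia.
Qed.

Lemma nearest_exists p n (c : nat -> V) :
  exists2 a, a <= n & forall j, j <= n -> dist p (c j) >= dist p (c a).
Proof.
have [|d /asboolP[a aN da] dmin] := @ex_minnP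
    (fun d => `[< exists2 a, a <= n & dist p (c a) = d >]).
  by exists (dist p (c 0)); apply/asboolP; exists 0.
by exists a => // j jN; rewrite da; apply/dmin/asboolP; exists j.
Qed.

(** Project [x] and [y] to [c a] and [c b] on a geodesic from [z] to [t]. By [right_angle], the
    distances from [x] and [y] to [z] and [t] are, up to an error, those of walks through the
    projections. If [a <= b], the pairing of [x] with [t] and [y] with [z] covers the stretch
    between the projections twice. *)
Lemma four_point_of_stokes K : stokes_bound K -> four_point (2 * (144 * K + 4)).
Proof.
move=> stokes x y z t.
have [c [gc c0 cz]] := geodesic_exists z t.
have [a aN anear] := nearest_exists x (dist z t) c.
have [b bN bnear] := nearest_exists y (dist z t) c.
have := right_angle stokes gc aN anear (leq0n _).
have := right_angle stokes gc aN anear (leqnn _).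
have := right_angle stokes gc bN bnear (leq0n _).
have := right_angle stokes gc bN bnear (leqnn _).
have := dist_tri (c a) x y; have := dist_tri (c b) (c a) y.
rewrite !(geodesic_dist gc) // c0 cz (distC x (c a)).
rewrite (distC x z) (distC y z) (distC x t) (distC y t).
case: (leqP a b) => ab; lia.
Qed.

(** * Periodic automorphisms of hyperbolic graphs *)

(** Periodicity makes a power of [g] its inverse, which therefore preserves edges too. *)
Definition periodic_automorphism (g : V -> V) : Prop :=
  (forall u v, e u v -> e (g u) (g v)) /\
  (exists2 N, 0 < N & forall v, iter N g v = v).

Lemma periodic_iter g k :
  periodic_automorphism g -> periodic_automorphism (iter k g).
Proof.
move=> [ge [N N0 gN]]; split.
  by elim: k => [|k IHk] u v //= /IHk /ge.
by exists N => // v; rewrite -iterM mulnC iterM; elim: k => //= k ->.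
Qed.

Lemma walk_map (S S' : V -> Prop) g x y n :
  (forall u v, e u v -> e (g u) (g v)) -> (forall v, S v -> S' (g v)) ->
  walk S x y n -> walk S' (g x) (g y) n.
Proof.
move=> ge SS' [p [pp <- <- pS]]; exists (map g p); split.
- by elim: p x pp {pS} => [|u p IHp] x //= /andP[/ge -> /IHp].
- by rewrite last_map.
- by rewrite size_map.
- by move=> v; rewrite -map_cons => /mapP[u /pS /SS' ? ->].
Qed.

Lemma periodic_dist g u v : periodic_automorphism g -> dist (g u) (g v) = dist u v.
Proof.
move=> [ge [[//|N] _ gN]].
have le h x y : (forall u v, e u v -> e (h u) (h v)) ->
    dist (h x) (h y) <= dist x y.
  by move=> he; apply: (@dist_le (fun=> True)); apply: walk_map (dist_walk x y).
have giter k : forall u v, e u v -> e (iter k g u) (iter k g v).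
  by elim: k => [|k IHk] x y //= /IHk /ge.
apply/eqP; rewrite eqn_leq le // -{1}(gN u) -{1}(gN v) !iterSr.
exact/le/giter.
Qed.

(** Otherwise the four-point condition at [p], [g^2 p], [g p], [g^(k+3) p] shows inductively that
    the distance from [p] to [g^k p] increases strictly with [k >= 1], whereas periodicity makes it
    return to 0. *)
Lemma four_point_turn delta g p : four_point delta -> periodic_automorphism g ->
  dist p (g (g p)) <= dist p (g p) + delta.
Proof.
move=> fp pg; rewrite leqNgt; apply/negP => big.
have shift k : dist (g p) (iter k.+1 g p) = dist p (iter k g p).
  by rewrite iterS periodic_dist.
have shift2 k : dist (g (g p)) (iter k.+2 g p) = dist p (iter k g p).
  by rewrite 2!iterS !periodic_dist.
have step k : dist p (iter k.+1 g p) < dist p (iter k.+2 g p).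
  elim: k => [|k IHk]; first by rewrite /=; lia.
  have := fp p (g (g p)) (g p) (iter k.+3 g p).
  rewrite !shift !shift2 (distC (g (g p))) (periodic_dist p (g p)) //.
  by move: IHk big; rewrite /=; lia.
have [_ [[//|[|N]] _ gN]] := pg.
  by have /= gp := gN p; rewrite !gp distxx in big.
by have := step N; rewrite gN distxx.
Qed.

(** Let [m] be the midpoint of a geodesic from [p] to [g p]. As [g^2 p] is not far from [p], the
    four-point condition bounds the distance from [p] to [g m] by about half of [l]. Applied again,
    it makes [m] move by less than [l] if [l] is large. *)
Lemma min_displacement_le delta g p : four_point delta ->
  periodic_automorphism g ->
  (forall q, dist p (g p) <= dist q (g q)) -> dist p (g p) <= 3 * delta + 1.
Proof.
move=> fp pg pmin; set l := dist p (g p); set h := l./2.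
have [c [gc c0 cl]] := geodesic_exists p (g p).
pose m := c h; have hl : h <= l by rewrite /h; lia.
have pm : dist p m = h by rewrite -c0 (geodesic_dist gc) //; lia.
have mgp : dist m (g p) = l - h.
  by rewrite -[in g p]cl (geodesic_dist gc) //; lia.
have turn := four_point_turn p fp pg.
have dg u v : dist (g u) (g v) = dist u v by apply: periodic_dist.
have := fp (g m) p (g p) (g (g p)); have := fp m (g m) (g p) p.
have := pmin m; rewrite !dg (distC (g m) p) (distC m p) pm mgp.
rewrite (distC (g p) p) -/l.
by rewrite /h; lia.
Qed.

Definition detour (T : nat) (v a b : V) : Prop :=
  exists2 n, n <= T & walk (fun u => u <> v) a b n.

Lemma detour_pull g T v a b : periodic_automorphism g ->
  detour T (g v) (g a) (g b) -> detour T v a b.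
Proof.
move=> pg [n nT]; have [_ [[//|N] _ gN]] := pg.
have [he _] := periodic_iter N pg.
move=> /(walk_map (S' := fun u => u <> v) he).
rewrite -!iterSr !gN => H; exists n => //; apply: H => u uv Nu.
by apply: uv; rewrite -Nu -iterS gN.
Qed.

Section Axis.
Variables (delta : nat) (g : V -> V) (l : nat) (s : nat -> V).
Hypothesis fp : four_point delta.
Hypothesis pg : periodic_automorphism g.
Hypothesis l_gt0 : 0 < l.
Hypothesis es : forall i, e (s i) (s i.+1).
Hypothesis sg : forall i, s (i + l) = g (s i).
Hypothesis l_min : forall v, l <= dist v (g v).

Lemma axis_shift i k : s (i + k * l) = iter k g (s i).
Proof. by elim: k => [|k IHk]; rewrite ?addn0 //= -IHk -sg -addnA mulSnr. Qed.

(** A stretch of length [l] joins a vertex to its image, and no vertex is displaced by less than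
    [l]. *)
Lemma axis_geodesic i : geodesic l (fun t => s (i + t)).
Proof.
apply: geodesic_of_walk => [t _|]; first by rewrite addnS.
by rewrite addn0 sg.
Qed.

(* Without short detours at the translates of [s i.+1], every geodesic joining
   two of them passes through those in between, so that [s] is a geodesic. *)
Lemma axis_no_detour T i k : ~ detour T (s i.+1) (s i) (s i.+2) ->
  (2 * k + 2) * l <= T -> dist (s i.+1) (s (i.+1 + k * l)) = k * l.
Proof.
move=> nodet; elim: k => [|k IHk] kT; first by rewrite addn0 distxx.
have {}IHk := IHk ltac:(nia); set w := s (i.+1 + k * l) in IHk.
have gw := axis_geodesic (i.+1 + k * l).
set q := s (i.+1 + k.+1 * l); have qE : q = s (i.+1 + k * l + l).
  by congr s; lia.
have wq : dist w q = l.
  by rewrite qE /w -[in s (_ + k * l)](addn0 (_ + k * l)) (geodesic_dist gw) //; lia.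
case: (posnP k) => [k0|k_gt0]; first by move: wq; rewrite /w k0 addn0 mul1n.
have nodet_w : ~ detour T w (s (i + k * l)) (s (i.+2 + k * l)).
  rewrite /w !axis_shift => dw; apply: nodet.
  exact: detour_pull (periodic_iter k pg) dw.
have := dist_tri w (s i.+1) q; rewrite IHk wq => le_q.
have gv : geodesic (k * l) (fun t => s (i.+1 + t)).
  apply: geodesic_of_walk => [t _|]; first by rewrite addnS.
  by rewrite addn0 -/w IHk.
have w_before t : t < k * l -> s (i.+1 + t) <> w.
  move=> tk tw; have := geodesic_dist gv (ltnW tk) (leqnn _).
  by rewrite /= -/w tw distxx; lia.
have w_after t : 0 < t -> t <= l -> s (i.+1 + k * l + t) <> w.
  move=> t0 tl tw; have := geodesic_dist gw (leq0n _) tl.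
  by rewrite /= addn0 -/w tw distxx; lia.
have [h [gh h0 hq]] := geodesic_exists (s i.+1) q.
have [[t tq ht]|noh] := pselect (exists2 t, t <= dist (s i.+1) q & h t = w).
  have := geodesic_dist gh (leq0n _) tq; have := geodesic_dist gh tq (leqnn _).
  by rewrite hq ht h0 wq IHk; lia.
case: nodet_w.
have w2 : walk (fun u => u <> w) (s i.+1) q (dist (s i.+1) q).
  rewrite -{1}h0 -{1}hq -{2}h0 -{2}hq.
  by apply: (geodesic_walk gh) => // t tq ht; apply: noh; exists t.
have w1 : walk (fun u => u <> w) (s i.+1) (s (i + k * l)) (i + k * l - i.+1).
  apply: walk_seq => [|//|j ij jk]; first by nia.
  by rewrite -(subnKC ij); apply: w_before; lia.
have w3 : walk (fun u => u <> w) (s (i.+2 + k * l)) q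
    (i.+1 + k * l + l - (i.+2 + k * l)).
  rewrite qE; apply: walk_seq => [|//|j ij jk]; first by lia.
  have -> : j = i.+1 + k * l + (j - (i.+1 + k * l)) by lia.
  by apply: w_after; lia.
(* Back along [s] to the start, along the geodesic [h] to [q], and back along [s]: the lengths are
   [k * l - 1], at most [k.+1 * l], and [l - 1]. *)
exists (i + k * l - i.+1 + (dist (s i.+1) q + (i.+1 + k * l + l - (i.+2 + k * l)))).
  by nia.
exact: walk_cat (walk_sym w1) (walk_cat w2 (walk_sym w3)).
Qed.

(** Otherwise [axis_no_detour] applies up to [k = 2 * delta.+1], whence the bound on [T]. Then
    [four_point_turn] for the power [delta.+1] of [g] gives
    [2 * delta.+1 * l <= delta.+1 * l + delta], which is absurd. *)
Lemma axis_detour T i : (4 * delta.+1 + 2) * l <= T ->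
  detour T (s i.+1) (s i) (s i.+2).
Proof.
move=> lT; apply: contrapT => nodet.
have := four_point_turn (s i.+1) fp (periodic_iter delta.+1 pg).
rewrite -iterD -!axis_shift !(axis_no_detour nodet); nia.
Qed.

End Axis.

Lemma axis_exists (v0 : V) delta g : four_point delta ->
  periodic_automorphism g ->
  (exists v, g v = v) \/
  exists l s, [/\ 0 < l <= 3 * delta + 1, forall i, e (s i) (s i.+1),
    forall i, s (i + l) = g (s i)
    & forall i, detour ((4 * delta.+1 + 2) * (3 * delta + 1))
                       (s i.+1) (s i) (s i.+2)].
Proof.
move=> fp pg.
have ex : exists d, `[< exists p, dist p (g p) = d >].
  by exists (dist v0 (g v0)); apply/asboolP; exists v0.
have [l /asboolP[p pl] lmin] := ex_minnP ex.
have {}lmin q : l <= dist q (g q) by apply/lmin/asboolP; exists q.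
have [l0|l_gt0] := posnP l.
  by left; exists p; apply/esym/dist_eq0; rewrite pl.
right; have [c [gc c0 cl]] := geodesic_exists p (g p); rewrite pl in gc cl.
have ll : l <= 3 * delta + 1.
  by rewrite -pl; apply: min_displacement_le fp pg _ => q; rewrite pl.
pose s i := iter (i %/ l) g (c (i %% l)).
(* The case [r = l] holds since [c l = g (c 0)]; it provides the edges between successive translates
   of [c]. *)
have sE q r : r <= l -> s (q * l + r) = iter q g (c r).
  rewrite leq_eqVlt => /orP[/eqP ->|rl]; rewrite /s.
    by rewrite -mulSnr mulnK // modnMl c0 iterSr -cl.
  by rewrite divnMDl // modnMDl divn_small // modn_small // addn0.
have es i : e (s i) (s i.+1).
  rewrite (divn_eq i l); have rl : i %% l < l by rewrite ltn_mod.
  rewrite -addnS !sE ?(ltnW rl) //; have [+ _] := periodic_iter (i %/ l) pg.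
  by apply; apply: gc.1.
have sg i : s (i + l) = g (s i) by rewrite /s divnDr ?dvdnn // divnn l_gt0 addn1 modnDr.
exists l, s; rewrite l_gt0 ll; split=> // i.
apply: (axis_detour fp pg l_gt0 es sg lmin).
by rewrite leq_mul2l ll orbT.
Qed.

End GraphDistance.

(** * The coned-off Cayley graph *)

Local Open Scope group_scope.

Section ConedOff.
Variables (G : groupType) (Lambda : Type) (H : Lambda -> groupClosed G).
Variable X : seq G.

Definition coset (l : Lambda) (g : G) : set G := [set x | g^-1 * x \in H l].

(** Storing the coset as a set identifies cone points given by different representatives; the index
    keeps those of different [H l] apart even if the sets coincide. *)
Record cone := MkCone {
  cone_index : Lambda;
  cone_set : set G;
  cone_setP : exists g, cone_set = coset cone_index g }.

Definition cone_of l g : cone :=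
  @MkCone l (coset l g) (ex_intro _ g erefl).

Inductive vertex := Elt of G | Cone of cone.

HB.instance Definition _ := gen_eqMixin cone.
HB.instance Definition _ := gen_eqMixin vertex.

Definition adj (u v : vertex) : bool :=
  match u, v with
  | Elt g, Elt h => (g^-1 * h \in X) || (h^-1 * g \in X)
  | Elt g, Cone c | Cone c, Elt g => `[< cone_set c g >]
  | Cone _, Cone _ => false
  end.

Lemma adj_sym : symmetric adj.
Proof. by move=> [g|c] [h|d] //=; rewrite orbC. Qed.

Lemma cone_eq c d :
  cone_index c = cone_index d -> cone_set c = cone_set d -> c = d.
Proof.
case: c d => [l A Ap] [m B Bp] /= lm AB; case: m / lm B Bp AB => B Bp AB.
by case: B / AB Bp => Bp; rewrite (Prop_irrelevance Ap Bp).
Qed.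

Lemma coset_eq l g h : g^-1 * h \in H l -> coset l g = coset l h.
Proof.
move=> gh; apply/seteqP; split=> x; rewrite /coset /= => xl.
  have -> : h^-1 * x = (g^-1 * h)^-1 * (g^-1 * x).
    by rewrite invgM invgK -!mulgA mulVKg.
  by rewrite gpredMr // gpredV.
have -> : g^-1 * x = (g^-1 * h) * (h^-1 * x) by rewrite -!mulgA mulVKg.
by rewrite gpredMr.
Qed.

Lemma cone_set_refl l g : cone_set (cone_of l g) g.
Proof. by rewrite /= /coset /= mulVg gpred1. Qed.

Lemma cone_ofE c g : cone_set c g -> c = cone_of (cone_index c) g.
Proof.
move=> cg; apply: cone_eq => //=; have [h ch] := cone_setP c.
by rewrite ch in cg *; apply: coset_eq.
Qed.

Lemma cone_of_eq l g h : h \in H l -> cone_of l (g * h) = cone_of l g.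
Proof. by move=> hl; apply/cone_eq/esym/coset_eq => //; rewrite mulKg. Qed.

Lemma act_cone_subproof (a : G) c :
  exists g, [set x | cone_set c (a^-1 * x)] = coset (cone_index c) g.
Proof.
have [g cg] := cone_setP c; exists (a * g); rewrite cg.
by apply/seteqP; split=> x; rewrite /coset /= invgM -mulgA.
Qed.

Definition act_cone a c := MkCone (act_cone_subproof a c).

Definition act (a : G) (v : vertex) : vertex :=
  match v with Elt g => Elt (a * g) | Cone c => Cone (act_cone a c) end.

Lemma act1 v : act 1 v = v.
Proof.
case: v => [g|c] /=; first by rewrite mul1g.
by congr Cone; apply: cone_eq => //=; apply/seteqP; split=> x /=; rewrite invg1 mul1g.
Qed.

Lemma actM a b v : act (a * b) v = act a (act b v).
Proof.
case: v => [g|c] /=; first by rewrite mulgA.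
congr Cone; apply: cone_eq => //=.
by apply/seteqP; split=> x /=; rewrite invgM mulgA.
Qed.

Lemma adj_act a u v : adj u v -> adj (act a u) (act a v).
Proof.
have aa (g h : G) : (a * g)^-1 * (a * h) = g^-1 * h.
  by rewrite invgM -mulgA mulKg.
by case: u v => [g|c] [h|d] //=; rewrite ?aa // mulKg.
Qed.

Lemma act_periodic a : finite_order a -> periodic_automorphism adj (act a).
Proof.
move=> [n /andP[n0 /eqP an]]; split; first exact: adj_act.
exists n => // v; rewrite -[RHS]act1 -an; elim: n {n0 an} => [|n IHn] /=.
  by rewrite act1.
by rewrite IHn expgS actM.
Qed.

(** The action on elements is free, and the stabilizer of the coset [g H_l] is a conjugate of
    [H_l]. *)
Lemma fixed_vertex a : a != 1 -> (exists v, act a v = v) -> ~ hyperbolic H a.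
Proof.
move=> a1 [[g|c]] /= [].
  by move=> ag; case/eqP: a1; apply: (mulIg g); rewrite ag mul1g.
have [g cg] := cone_setP c; case=> ac; apply.
have : cone_set (act_cone a c) (a * g) by rewrite /= mulKg cg /coset /= mulVg gpred1.
rewrite ac cg /coset /= => agH; exists (cone_index c), (g^-1 * (a * g)) => //.
by exists g.
Qed.

Local Notation word := (word H X).

Section WordIntegral.
Variable w : vertex -> vertex -> Z.

(** A peripheral letter is traced by two edges through a cone point, so a word of length n traces a
    walk of length at most 2n. *)
Definition letter_integral (g : G) (a : letter H X) : Z :=
  match a with
  | Gen _ _ => w (Elt g) (Elt (g * letter_val a))
  | Per l h =>
      w (Elt g) (Cone (cone_of l g)) + w (Cone (cone_of l g)) (Elt (g * val h))
  end%Z.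

Fixpoint word_integral (g : G) (u : word) : Z :=
  if u is a :: u' then
    (letter_integral g a + word_integral (g * letter_val a) u')%Z
  else 0%Z.

Lemma word_val_cons a (u : word) : word_val (a :: u) = letter_val a * word_val u.
Proof. by rewrite /word_val big_cons. Qed.

Lemma word_val_cat (u v : word) : word_val (u ++ v) = word_val u * word_val v.
Proof. exact: big_cat. Qed.

Lemma word_integral_cat g (u v : word) :
  word_integral g (u ++ v) =
  (word_integral g u + word_integral (g * word_val u) v)%Z.
Proof.
elim: u g => [|a u IHu] g /=; first by rewrite /word_val big_nil mulg1.
by rewrite IHu word_val_cons mulgA Z.add_assoc.
Qed.

Hypothesis w_anti : forall u v, w u v = (- w v u)%Z.

Lemma word_integral_subst g (u p q v : word) : word_val p = word_val q ->
  (forall h, word_integral h p = word_integral h q) ->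
  word_integral g (u ++ p ++ v) = word_integral g (u ++ q ++ v).
Proof. by move=> pq Ipq; rewrite !word_integral_cat pq Ipq. Qed.

(** Two successive letters of one [H l] pass through the same cone point, so the edges from it to
    the middle element and back cancel by antisymmetry. *)
Lemma word_integral_equiv g (u v : word) :
  word_class u = word_class v -> word_integral g u = word_integral g v.
Proof.
move=> /word_classP; elim=> {u v} [u v []|//|u v _ ->//|u v t _ -> _ ->//].
- move=> {}u {}v x b; apply: (@word_integral_subst g u _ [::] v) => [|h].
    exact/word_val_equiv/rst_step/(step_gen [::] [::]).
  rewrite /= -mulgA (_ : (if b then _ else _) * _ = 1) ?mulg1.
    by rewrite (w_anti (Elt h)); lia.
  by case: b; rewrite /= ?mulVg ?mulgV.
- move=> {}u {}v l h k hk; apply: (@word_integral_subst g u _ [::] v) => [|t].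
    exact/word_val_equiv/rst_step/(step_per1 [::] [::]).
  rewrite /= cone_of_eq; last by case/andP: (valP h).
  rewrite -mulgA hk mulg1 (w_anti (Elt t)) (w_anti (Elt (_ * _))).
  by lia.
- move=> {}u {}v l h k m hk; apply: word_integral_subst => [|t].
    exact/word_val_equiv/rst_step/(step_perM [::] [::]).
  rewrite /= cone_of_eq; last by case/andP: (valP h).
  rewrite -mulgA hk (w_anti (Elt (t * val h))).
  have E a b c : (a + b + (- b + c + 0) = a + c + 0)%Z by lia.
  exact: E.
Qed.

Definition class_integral (g : G) (a : relfree H X) : Z :=
  word_integral g (repr a).

Lemma class_integralE g (u : word) :
  class_integral g (word_class u) = word_integral g u.
Proof. by apply: word_integral_equiv; rewrite word_class_repr. Qed.

Lemma class_integralM g (a b : relfree H X) :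
  class_integral g (a * b) =
  (class_integral g a + class_integral (g * canonical_map a) b)%Z.
Proof. by rewrite [a * b]/(relfree_mul a b) class_integralE word_integral_cat. Qed.

Lemma class_integral1 g : class_integral g 1 = 0%Z.
Proof. exact: (class_integralE g [::]). Qed.

(** As [a] closes up, the walks of [f^-1] and [f] are inverse to each other and cancel. *)
Lemma class_integralJ g (a f : relfree H X) : canonical_map a = 1 ->
  class_integral g (a ^ f) = class_integral (g * (canonical_map f)^-1) a.
Proof.
move=> a1; have := class_integralM g f^-1 f; rewrite mulVg class_integral1.
have E b c d : (0 = b + d -> b + (c + d) = c)%Z by lia.
by rewrite conjgE !class_integralM gmulfV a1 mulg1 => /E ->.
Qed.

(* Homological form of the linear isoperimetric inequality: a conjugate of a
   relator contributes the integral along a translate of that relator. *)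
Lemma conjugates_integral_le (R : seq word) B k (u : word) g :
  (forall r, r \in R -> word_val r = 1) ->
  (forall h r, r \in R -> (Z.abs (word_integral h r) <= Z.of_nat B)%Z) ->
  product_of_conjugates R u k ->
  (Z.abs (word_integral g u) <= Z.of_nat (B * k))%Z.
Proof.
move=> R1 RB [f [r [rR uE]]]; rewrite -class_integralE uE {u uE}.
elim: k f r rR g => [|k IHk] f r rR g.
  by rewrite big_ord0 class_integral1; lia.
have r1 : canonical_map (word_class (r ord0)) = 1.
  by rewrite canonical_mapE R1.
rewrite big_ord_recl class_integralM class_integralJ // class_integralE.
have := RB (g * (canonical_map (f ord0))^-1) _ (rR ord0).
set h := g * canonical_map _.
have := IHk (f \o lift ord0) (r \o lift ord0) (fun i => rR _) h.
by rewrite /=; lia.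
Qed.

End WordIntegral.

End ConedOff.

Arguments Elt {G Lambda H}.

(** * Words and walks in the coned-off graph *)

Section Words.
Variables (G : groupType) (Lambda : Type) (H : Lambda -> groupClosed G).
Variable X : seq G.
Local Notation word := (word H X).
Local Notation vertex := (vertex H).
Local Notation adj := (adj (H := H) X).

(** Given the structure of a subgroup below, since [generated] quantifies over subgroups. *)
Definition word_image : {pred G} := fun g => `[< exists u : word, word_val u = g >].

Fact word_imageM : mulg_closed word_image.
Proof.
move=> g h /asboolP[u <-] /asboolP[v <-]; apply/asboolP.
by exists (u ++ v); rewrite word_val_cat.
Qed.

Fact word_image1 : 1 \in word_image.
Proof. by apply/asboolP; exists [::]; rewrite /word_val big_nil. Qed.

Fact word_imageV : invg_closed word_image.
Proof.
move=> g /asboolP[u <-]; apply/asboolP; exists (inv_word u).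
apply/esym/mulg1_eq; rewrite -word_val_cat (word_val_equiv (inv_wordV u)).
by rewrite /word_val big_nil.
Qed.

HB.instance Definition _ := isMulClosed.Build G word_image word_imageM.
HB.instance Definition _ := isMul1Closed.Build G word_image word_image1.
HB.instance Definition _ := isInvClosed.Build G word_image word_imageV.

Lemma word_val_surj : relative_generating_set H X ->
  forall g, exists u : word, word_val u = g.
Proof.
move=> gen g; suff : g \in word_image by move=> /asboolP.
have : generated [set g | g \in X \/ exists l, g \in H l] g.
  by rewrite [generated _]gen.
apply=> a [aX|[l al]]; apply/asboolP.
  by exists [:: Gen H (SeqSub aX) false]; rewrite /word_val big_seq1.
have [->|a1] := eqVneq a 1; first by exists [::]; rewrite /word_val big_nil.
have aP : (a \in H l) && (a != 1) by rewrite al.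
by exists [:: Per X (exist _ a aP)]; rewrite /word_val big_seq1.
Qed.

Lemma adj_gen g (x : seq_sub X) b : adj (Elt g) (Elt (g * letter_val (Gen H x b))).
Proof.
case: b; rewrite /adj /= ?mulKg ?(valP x) // invgM invgK mulgVK.
by rewrite (valP x) orbT.
Qed.

Lemma adj_cone_of l g : adj (Elt g) (Cone (cone_of H l g)).
Proof. exact/asboolP/cone_set_refl. Qed.

Lemma adj_per g l (h : {h : G | (h \in H l) && (h != 1)}) :
  adj (Cone (cone_of H l g)) (Elt (g * val h)).
Proof. by apply/asboolP; rewrite /= /coset /= mulKg; case/andP: (valP h). Qed.

Lemma adj_connected : relative_generating_set H X ->
  forall u v : vertex, exists p, path adj u p /\ last u p = v.
Proof.
move=> gen.
have trans (a b c : vertex) : (exists p, path adj a p /\ last a p = b) ->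
    (exists p, path adj b p /\ last b p = c) ->
    exists p, path adj a p /\ last a p = c.
  move=> [p [pp pl]] [q [qp ql]]; exists (p ++ q).
  by rewrite cat_path last_cat pl pp qp.
have edge (a b : vertex) : adj a b -> exists p, path adj a p /\ last a p = b.
  by move=> ab; exists [:: b]; rewrite /= ab.
have elts (u : word) g :
    exists p, path adj (Elt g) p /\ last (Elt g) p = Elt (g * word_val u).
  elim: u g => [|a u IHu] g; first by exists [::]; rewrite /word_val big_nil mulg1.
  rewrite word_val_cons mulgA; apply: (trans _ _ _ _ (IHu _)).
  case: a => [x b|l h]; first exact/edge/adj_gen.
  apply: (trans _ (Cone (cone_of H l g))); apply: edge; first exact: adj_cone_of.
  exact: adj_per.
have cone_elt (c : cone H) : exists g, cone_set c g.
  have [g ->] := cone_setP c; exists g.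
  by rewrite /coset /= mulVg gpred1.
have to_elt (u : vertex) : exists g, exists p, path adj u p /\ last u p = Elt g.
  case: u => [g|c]; first by exists g, [::].
  have [g cg] := cone_elt c; exists g; apply: edge; exact/asboolP.
have from_elt (v : vertex) :
    exists g, exists p, path adj (Elt g) p /\ last (Elt g) p = v.
  case: v => [g|c]; first by exists g, [::].
  have [g cg] := cone_elt c; exists g; apply: edge; exact/asboolP.
move=> u v; have [g ug] := to_elt u; have [h hv] := from_elt v.
apply: (trans _ _ _ ug); apply: (trans _ _ _ _ hv).
by have [t tE] := word_val_surj gen (g^-1 * h); have := elts t g; rewrite tE mulVKg.
Qed.

Lemma word_of_path w g p h : (forall u v, w u v = (- w v u)%Z) ->
  path adj (Elt g) p -> last (Elt g) p = Elt h ->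
  exists u : word, [/\ size u <= size p, g * word_val u = h
                     & word_integral w g u = integral w (Elt g) p].
Proof.
move=> w_anti; have [n] := ubnP (size p); elim: n g p => // n IHn g [|[g1|c] p] /=.
- by move=> _ _ [<-]; exists [::]; rewrite /word_val big_nil mulg1.
- move=> pn /andP[gg1 pp] pl; have [//|u [us ug uI]] := IHn g1 p _ pp pl.
  have [x xE] : exists x : letter H X, letter_val x = g^-1 * g1 /\
      letter_integral w g x = w (Elt g) (Elt g1).
    case/orP: gg1 => xX.
      exists (Gen H (SeqSub xX) false); rewrite /letter_integral /=.
      by rewrite mulVKg.
    exists (Gen H (SeqSub xX) true); rewrite /letter_integral /=.
    by rewrite invgM invgK mulVKg.
  exists (x :: u); split; first by rewrite /=; lia.
    by rewrite word_val_cons xE.1 mulgA mulVKg.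
  by rewrite /= xE.1 xE.2 mulVKg uI.
- case: p => [|[g1|d] p] //=; last by rewrite andbF.
  move=> pn /and3P[/asboolP cg /asboolP cg1 pp] pl.
  have [|u [us ug uI]] := IHn g1 p _ pp pl; first by lia.
  (* Peripheral letters are nontrivial, so backtracking at a cone point yields no letter; its two
     edges cancel by antisymmetry. *)
  have [gg1|gg1] := eqVneq g g1.
    subst g1; exists u; split=> //; first by lia.
    by rewrite uI (w_anti (Cone c)); lia.
  have hP : (g^-1 * g1 \in H (cone_index c)) && (g^-1 * g1 != 1).
    move: cg1; rewrite {1}(cone_ofE cg) /= /coset /= => -> /=.
    by rewrite mulg_eq1 (inj_eq invg_inj) in gg1 *.
  pose k : {k : G | (k \in H (cone_index c)) && (k != 1)} :=
    Sub (g^-1 * g1) hP.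
  exists (Per X k :: u); split; first by rewrite /=; lia.
    by rewrite word_val_cons /= mulgA mulVKg.
  rewrite /= -(cone_ofE cg) mulVKg uI; exact/esym/Z.add_assoc.
Qed.

End Words.

(** * Consequences of the linear isoperimetric inequality *)

Section LinearIsoperimetry.
Variables (G : groupType) (Lambda : Type) (H : Lambda -> groupClosed G).
Variables (X : seq G) (R : seq (word H X)) (L : nat).
Hypothesis R_trivial : forall r, r \in R -> word_val r = 1.
Hypothesis isoperimetry : forall u : word H X, word_val u = 1 ->
  exists2 k, k <= L * size u & product_of_conjugates R u k.
Local Notation word := (word H X).
Local Notation vertex := (vertex H).
Local Notation adj := (adj (H := H) X).

Lemma closed_path_integral_le w B (x : vertex) p :
  (forall u v, w u v = (- w v u)%Z) ->
  (forall h r, r \in R -> (Z.abs (word_integral w h r) <= Z.of_nat B)%Z) ->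
  path adj x p -> last x p = x ->
  (Z.abs (integral w x p) <= Z.of_nat (B * (L * size p)))%Z.
Proof.
move=> w_anti RB pp pl.
have main g q : path adj (Elt g) q -> last (Elt g) q = Elt g ->
    (Z.abs (integral w (Elt g) q) <= Z.of_nat (B * (L * size q)))%Z.
  move=> qp ql; have [u [us ug <-]] := word_of_path w_anti qp ql.
  have u1 : word_val u = 1 by apply: (mulgI g); rewrite mulg1.
  have [k kL uk] := isoperimetry u1.
  have := conjugates_integral_le w_anti (g := g) R_trivial RB uk.
  have : B * k <= B * (L * size q).
    by rewrite leq_mul2l (leq_trans kL) ?orbT // leq_mul2l us orbT.
  by lia.
case: x pp pl => [g|c] pp pl; first exact: main.
(* A closed walk based at a cone point is rotated to start at its next vertex, an element. *)
case: p pp pl => [|[g|d] p] //=; first by lia.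
move=> /andP[cg pp] pl; have := main g (p ++ [:: Elt g]).
rewrite cat_path pp pl last_cat size_cat addn1 /= cg => /(_ isT erefl).
by rewrite integral_cat pl /=; lia.
Qed.

Lemma form_anti (f1 f2 : vertex -> Z) u v : form f1 f2 u v = (- form f1 f2 v u)%Z.
Proof. by rewrite /form; lia. Qed.

Lemma form_step f1 f2 u v c N : lipschitz adj f2 -> adj u v ->
  (Z.abs (f1 u - c) <= Z.of_nat N -> Z.abs (f1 v - c) <= Z.of_nat N ->
  Z.abs (form f1 f2 u v - 2 * c * (f2 v - f2 u)) <= Z.of_nat (2 * N))%Z.
Proof.
move=> lip2 /lip2 uv u1 v1.
have -> : (form f1 f2 u v - 2 * c * (f2 v - f2 u) =
           (f1 u + f1 v - 2 * c) * (f2 v - f2 u))%Z by rewrite /form; lia.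
by rewrite Z.abs_mul; nia.
Qed.

Lemma abs_telescope c x y z A B a b :
  (Z.abs (A - 2 * c * (y - x)) <= a -> Z.abs (B - 2 * c * (z - y)) <= b ->
   Z.abs (A + B - 2 * c * (z - x)) <= a + b)%Z.
Proof.
have -> : (A + B - 2 * c * (z - x) =
  (A - 2 * c * (y - x)) + (B - 2 * c * (z - y)))%Z by ring.
by lia.
Qed.

(** Replacing [f1] by the constant [c] turns the form into [2 * c * df2], which telescopes. The walk
    has at most [2 * size u] edges, so [f1] stays within [N] of [c] on it, and each edge costs at
    most [2 * N]. *)
Lemma form_word_le f1 f2 c N g (u : word) : lipschitz adj f1 -> lipschitz adj f2 ->
  (Z.abs (f1 (Elt g) - c) + Z.of_nat (2 * size u) <= Z.of_nat N ->
   Z.abs (word_integral (form f1 f2) g u -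
          2 * c * (f2 (Elt (g * word_val u)) - f2 (Elt g)))
   <= Z.of_nat (4 * N * size u))%Z.
Proof.
move=> lip1 lip2; elim: u g => [|a u IHu] g.
  by rewrite /word_val big_nil mulg1 /=; lia.
rewrite [size (a :: u)]/= [word_integral _ _ _]/= word_val_cons mulgA => gN.
case: a => [x b|l h].
  set g' := g * letter_val _; have gg' : adj (Elt g) (Elt g') by exact: adj_gen.
  have f1gg' := lip1 _ _ gg'; have := IHu g' ltac:(lia).
  have := @form_step f1 f2 _ _ c N lip2 gg' ltac:(lia) ltac:(lia).
  move=> stepA stepB; apply: Z.le_trans (abs_telescope stepA stepB) _.
  by rewrite mulnS; lia.
set g' := g * letter_val _; set d := Cone (cone_of H l g).
have gd : adj (Elt g) d by exact: adj_cone_of.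
have dg' : adj d (Elt g') by exact: adj_per.
have f1gd := lip1 _ _ gd; have f1dg' := lip1 _ _ dg'; have := IHu g' ltac:(lia).
have stepA := @form_step f1 f2 _ _ c N lip2 gd ltac:(lia) ltac:(lia).
have stepB := @form_step f1 f2 _ _ c N lip2 dg' ltac:(lia) ltac:(lia).
move=> stepC.
apply: Z.le_trans (abs_telescope (abs_telescope stepA stepB) stepC) _.
by rewrite mulnS; lia.
Qed.

Definition max_size := \max_(r <- R) size r.

Lemma size_le_max r : r \in R -> size r <= max_size.
Proof. by move=> rR; apply: leq_bigmax_seq. Qed.

(** Along a relator, take for [c] the value of [f1] at the start: the main term vanishes because the
    walk closes, and the error is quadratic in the length of the relator. *)
Lemma coned_off_stokes : stokes_bound adj (8 * max_size * max_size * L).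
Proof.
move=> f1 f2 lip1 lip2 x p pp pl.
have := closed_path_integral_le (B := 8 * max_size * max_size)
  (form_anti f1 f2) _ pp pl.
rewrite mulnA; apply=> h r rR.
have rM := size_le_max rR.
have := @form_word_le f1 f2 (f1 (Elt h)) (2 * size r) h r lip1 lip2.
rewrite Z.sub_diag => /(_ (Z.le_refl _)).
rewrite R_trivial // mulg1 Z.sub_diag Z.mul_0_r Z.sub_0_r => H1.
have : 4 * (2 * size r) * size r <= 8 * max_size * max_size.
  by rewrite mulnA; apply: leq_mul => //; rewrite leq_mul2l rM.
by move=> /leP/Nat2Z.inj_le; apply: Z.le_trans H1.
Qed.

(** * Balls in the group and angles at a cone point *)

Fixpoint ball (A : seq G) (n : nat) : seq G :=
  if n is n'.+1 then [seq a * b | a <- ball A n', b <- 1 :: A] else [:: 1].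

Lemma ball_mul A n a b : a \in ball A n -> b \in A -> a * b \in ball A n.+1.
Proof. by move=> an bA; apply: allpairs_f => //; rewrite inE bA orbT. Qed.

Lemma ball_le A n m : n <= m -> {subset ball A n <= ball A m}.
Proof.
move=> nm; rewrite -(subnKC nm); elim: (m - n) => [|k IHk] a an.
  by rewrite addn0.
rewrite addnS -[a]mulg1; apply: allpairs_f; [exact: IHk|exact: mem_head].
Qed.

Lemma ball1 A n : 1 \in ball A n.
Proof. by apply: (@ball_le A 0) => //; rewrite inE. Qed.

Definition relator_letters : seq G :=
  let s := [seq letter_val a | a <- flatten R] in s ++ [seq a^-1 | a <- s].

Lemma relator_letter r a : r \in R -> a \in r ->
  letter_val a \in relator_letters /\ (letter_val a)^-1 \in relator_letters.
Proof.
move=> rR ar; have aR : letter_val a \in [seq letter_val a | a <- flatten R].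
  by apply/map_f/flattenP; exists r.
by rewrite !mem_cat aR map_f ?orbT.
Qed.

Section Angle.
Variables (c : cone H) (a : G) (N : nat).

(* The distance from [a] in the Cayley graph of [relator_letters], cut at [N]. *)
Definition angle (g : G) : nat :=
  \sum_(i < N) ((a^-1 * g)%g \notin ball relator_letters i).

(** Drop the first term on the left and the last on the right, and compare the ball of radius [i.+1]
    with that of radius [i]. *)
Lemma angle_mul g b : b \in relator_letters -> angle (g * b) <= (angle g).+1.
Proof.
move=> bR; rewrite /angle; case: N => [|n]; first by rewrite !big_ord0.
rewrite big_ord_recl big_ord_recr /= -[X in _ <= X]add1n leq_add ?leq_b1 //.
apply: leq_trans (leq_addr _ _); apply: leq_sum => i _; rewrite mulgA.
case: (boolP (a^-1 * g \in _)) => [gi|_]; last exact: leq_b1.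
by rewrite (ball_mul gi bR).
Qed.

Lemma angle_start : angle a = 0.
Proof. by rewrite /angle big1 // => i _; rewrite mulVg ball1. Qed.

Lemma angle_lt g : angle g < N -> a^-1 * g \in ball relator_letters N.
Proof.
move=> gN; apply: contraLR gN => gN; rewrite -leqNgt /angle.
rewrite -[X in X <= _]card_ord -sum1_card; apply: leq_sum => i _.
case: (boolP (_ \in ball _ i)) => // gi.
by rewrite (ball_le (ltnW (ltn_ord i)) gi) in gN.
Qed.

Definition cone_form (u v : vertex) : Z :=
  match u, v with
  | Elt g, Cone d => if d == c then Z.of_nat (angle g) else 0
  | Cone d, Elt g => if d == c then - Z.of_nat (angle g) else 0
  | _, _ => 0
  end%Z.

Lemma cone_form_anti u v : cone_form u v = (- cone_form v u)%Z.
Proof. by case: u v => [g|d] [h|d'] //=; case: eqP; lia. Qed.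

(** Only a peripheral letter [h] read through [c] contributes, namely [angle g - angle (g * h)]. *)
Lemma cone_form_word g (u : word) : {in u, forall b,
    letter_val b \in relator_letters /\ (letter_val b)^-1 \in relator_letters} ->
  (Z.abs (word_integral cone_form g u) <= Z.of_nat (size u))%Z.
Proof.
elim: u g => [|b u IHu] g uR; first by rewrite /=; lia.
have /= := IHu (g * letter_val b) (fun d du => uR d (mem_behead (s := b :: u) du)).
have [bR bVR] := uR b (mem_head _ _).
suff : (Z.abs (letter_integral cone_form g b) <= 1)%Z by rewrite /=; lia.
case: b bR bVR {uR} => [x e|l h] hR hVR; first by rewrite /=; lia.
rewrite /letter_integral /=; case: eqP => _; last by lia.
have := angle_mul (g * val h) hVR; rewrite mulgK.
have E m n : m <= n.+1 -> n <= m.+1 -> (Z.abs (Z.of_nat m - Z.of_nat n) <= 1)%Z.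
  by lia.
by move/E; apply; apply: angle_mul.
Qed.

Lemma cone_form_avoid x p : (forall v, v \in x :: p -> v <> Cone c) ->
  integral cone_form x p = 0%Z.
Proof.
elim: p x => [|y p IHp] x //= out.
rewrite IHp => [|v vp]; last by apply: out; rewrite inE vp orbT.
have := out x (mem_head _ _); have := out y; rewrite !inE eqxx orbT => /(_ isT).
case: x y {out IHp} => [g|d] [h|d'] //=; case: eqP => // ->; last by [].
by move=> /(_ erefl).
Qed.

End Angle.

(** Close the detour through the cone point. Of this walk of length [n.+2] only the first and last
    edges contribute, giving the angle of [b]. The cutoff [N] exceeds the resulting bound, so this
    angle is a true distance. *)
Lemma detour_angle T c a b : cone_set c a -> cone_set c b ->
  detour adj T (Cone c) (Elt a) (Elt b) ->
  a^-1 * b \in ball relator_letters (max_size * (L * T.+2)).+1.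
Proof.
move=> ca cb [n nT [p [pp pl pn avoid]]]; set N := (_ * _).+1.
apply: angle_lt.
have := closed_path_integral_le (w := cone_form c a N) (B := max_size)
  (x := Cone c) (p := Elt a :: p ++ [:: Cone c]) (cone_form_anti c a N).
rewrite /= cat_path last_cat pp pl /= integral_cat cone_form_avoid // pl /=.
rewrite eqxx angle_start size_cat pn addn1.
have -> : `[< cone_set c a >] by apply/asboolP.
have -> : `[< cone_set c b >] by apply/asboolP.
move=> /(_ _ isT erefl); have : max_size * (L * n.+2) < N.
  by rewrite ltnS leq_mul2l leq_mul2l !ltnS nT !orbT.
move=> nN /(_ _); set A := angle _ _ _; move=> H1.
suff : (Z.abs (- Z.of_nat 0 + (0 + (Z.of_nat A + 0))) <=
        Z.of_nat (max_size * (L * n.+2)))%Z by lia.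
apply: H1 => h r rR.
have := @cone_form_word c a N h r (fun d => @relator_letter r d rR).
move=> /Z.le_trans; apply; exact/Nat2Z.inj_le/leP/size_le_max.
Qed.

End LinearIsoperimetry.

(** * Elements of finite order *)

Section FiniteOrder.
Variables (G : groupType) (Lambda : Type) (H : Lambda -> groupClosed G).
Local Notation vertex := (vertex H).
Local Notation Elt := (@Elt G Lambda H).

(** Each edge between elements, and each pair of edges through a cone point, multiplies by an
    element of [A]. *)
Lemma walk_in_ball (X A : seq G) (s : nat -> vertex) :
  (forall x, x \in X -> x \in A /\ x^-1 \in A) ->
  (forall i, adj X (s i) (s i.+1)) ->
  (forall i c a b, s i = Elt a -> s i.+1 = Cone c -> s i.+2 = Elt b ->
     a^-1 * b \in A) ->
  forall k i a b, s i = Elt a -> s (i + k) = Elt b -> a^-1 * b \in ball A k.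
Proof.
move=> XA es turn k i a b sa; have [n] := ubnP k.
elim: n k b => // n IHn [|k] b kn.
  by rewrite addn0 sa => -[<-]; rewrite mulVg ball1.
have comp g m : m <= k -> a^-1 * g \in ball A m -> g^-1 * b \in A ->
    a^-1 * b \in ball A k.+1.
  move=> mk ag gb; rewrite -[b](mulVKg g) mulgA; apply: ball_mul => //.
  exact: ball_le mk _ ag.
rewrite addnS => sb; have := es (i + k); case sk : (s (i + k)) => [g|c]; rewrite sb.
  move=> /= gb; apply: (comp g k) => //; first by apply: IHn.
  case/orP: gb => [/XA[]//|/XA[_]]; by rewrite invgM invgK.
move=> _; case: k kn comp sb sk => [|k] kn comp sb sk.
  by rewrite addn0 sa in sk.
rewrite addnS in sk sb; have := es (i + k).
rewrite sk; case sg : (s (i + k)) => [g|//] _.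
apply: (comp g k) => //; last exact: turn sg sk sb.
by apply: IHn sg; lia.
Qed.

Lemma finite_order_representatives : relatively_hyperbolic H ->
  exists S : seq G, forall g, hyperbolic H g -> finite_order g ->
    exists z, g ^ z \in S.
Proof.
move=> [X [R [[gen _ _ RK] [f [iso _] [L fL]]]]].
have R1 r : r \in R -> word_val r = 1.
  move=> rR; have : kernel (@canonical_map G Lambda H X) (word_class r).
    by rewrite -RK => N _ RN; apply: RN; exists r.
  by rewrite /kernel /= canonical_mapE.
have isoL u : word_val u = 1 ->
    exists2 k, k <= L * size u & product_of_conjugates R u k.
  move=> u1; have [k kf uk] := iso _ u (leqnn _) u1.
  by exists k => //; apply: leq_trans kf (fL _).
have asym := @adj_sym G Lambda H X; have conn := adj_connected gen.
have fp := four_point_of_stokes asym conn (coned_off_stokes R1 isoL).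
set delta := (X in four_point _ X) in fp.
set T := ((4 * delta.+1 + 2) * (3 * delta + 1))%N.
(* Generators and their inverses account for edges between elements, the ball of [detour_angle] for
   passages through cone points. *)
pose A := X ++ [seq x^-1 | x <- X] ++
          ball (relator_letters R) (max_size R * (L * T.+2))%N.+1.
exists (ball A (3 * delta + 1)) => g hg og.
(* The identity fixes every vertex and is hyperbolic when [Lambda] is empty. *)
have [->|g1] := eqVneq g 1; first by exists 1; rewrite conj1g ball1.
have := axis_exists asym (Elt 1) fp (act_periodic H X og).
case=> [/(fixed_vertex g1) //|[l [s [/andP[l0 lT] es sg turn]]]].
(* Cone points are never adjacent, so one of the first two vertices is an element. *)
have [i [x sx]] : exists i x, s i = Elt x.
  case s0 : (s 0) => [x|c]; first by exists 0, x.
  have := es 0; rewrite s0; case s1 : (s 1%N) => [x|//] _; by exists 1%N, x.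
exists x; apply: (ball_le lT).
have sgx : s (i + l) = Elt (g * x) by rewrite sg sx.
rewrite conjgE; apply: walk_in_ball sx sgx => //.
  move=> y yX; rewrite !mem_cat yX; split=> //.
  by rewrite map_f ?orbT.
move=> j c a b sa sc sb; rewrite !mem_cat; apply/orP; right; apply/orP; right.
have := turn j; rewrite sa sb sc; apply: (detour_angle R1 isoL).
  by have := es j; rewrite sa sc => /asboolP.
by have := es j.+1; rewrite sb sc => /asboolP.
Qed.

End FiniteOrder.

(** * Conjugacy invariance and the conclusion *)

Section Conjugacy.
Variable G : groupType.
Implicit Types x z : G.

Lemma conj_classJ x z : conj_class (x ^ z) = conj_class x.
Proof.
apply/seteqP; split=> _ [t ->]; first by exists (z * t); rewrite conjgM.
by exists (z^-1 * t); rewrite -conjgM mulVKg.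
Qed.

Lemma element_orderJ x z : element_order (x ^ z) = element_order x.
Proof.
have E n : ((0 < n) && ((x ^ z) ^+ n == 1)) = ((0 < n) && (x ^+ n == 1)).
  by rewrite -conjXg conjg_eq1.
rewrite /element_order; case: pselect => [ex1|no1]; case: pselect => [ex2|no2] //.
- by congr Some; apply: eq_ex_minn.
- by case: no2; have [n En] := ex1; exists n; rewrite -E.
- by case: no1; have [n En] := ex2; exists n; rewrite E.
Qed.

Lemma element_order_infinite x : ~ finite_order x -> element_order x = None.
Proof. by rewrite /element_order; case: pselect. Qed.

End Conjugacy.

Theorem theorem1p12 (G : groupType) (Lambda : Type)
    (H : Lambda -> groupClosed G) :
  relatively_hyperbolic H ->
  finite_set [set conj_class g | g in
                [set g : G | hyperbolic H g /\ finite_order g]] /\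
  finite_set [set element_order g | g in [set g : G | hyperbolic H g]].
Proof.
move=> /finite_order_representatives[S repS]; split.
  apply: sub_finite_set (finite_image (@conj_class G) (finite_seq S)).
  move=> _ [g [hg og] <-]; have [z zS] := repS g hg og.
  by exists (g ^ z) => //; apply: conj_classJ.
(* The value [None] accounts for the hyperbolic elements of infinite order. *)
have : finite_set ([set None] `|` [set element_order g | g in [set` S]]).
  by rewrite finite_setU; split; [apply: finite_set1|exact/finite_image/finite_seq].
apply: sub_finite_set => _ [g hg <-].
have [og|nog] := pselect (finite_order g); last first.
  by left; apply: element_order_infinite.
have [z zS] := repS g hg og; right.
by exists (g ^ z) => //; apply: element_orderJ.
Qed.
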